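(* Let $S\subseteq\mathbb{R}^n$ be a closed and rational MICP-R set. If there exists a uniform upper bound on the diameter of any convex subset of $S$ (i.e. there is $D<\infty$ such that every convex set $C\subseteq S$ has diameter at most $D$), then there exist $k_1,k_2\in\mathbb{Z}_+$, compact convex sets $C_1,\dots,C_{k_1}$ and closed periodic sets $S_1,\dots,S_{k_2}$ such that $$S=\Big(\bigcup_{j=1}^{k_1}C_j\Big)\cup\Big(\bigcup_{i=1}^{k_2}S_i\Big).$$
   Context: $\mathbb{N}=\{1,2,\dots\}$, $\mathbb{Z}_+=\{0,1,2,\dots\}$; $n\in\mathbb{N}$, $p,d\in\mathbb{Z}_+$. A closed convex set $M\subseteq\mathbb{R}^{n+p+d}$ (with $d$) induces an MICP formulation of $S\subseteq\mathbb{R}^n$ if for every $x\in\mathbb{R}^n$: $x\in S$ iff there exist $y\in\mathbb{R}^p$, $z\in\mathbb{Z}^d$ with $(x,y,z)\in M$. The index set of the formulation is $I=\operatorname{proj}_z(M)\subseteq\mathbb{R}^d$, the projection of $M$ onto the last $d$ coordinates. For a convex (not necessarily closed) set $C\subseteq\mathbb{R}^d$, its recession cone is $C_\infty=\{r\in\mathbb{R}^d : x+\lambda r\in C\ \ \forall x\in C,\ \lambda\ge 0\}$. A convex set $I\subseteq\mathbb{R}^d$ is rationally unbounded if for every image $I'\subseteq\mathbb{R}^{d'}$ of $I$ under a rational affine map (a map $z\mapsto Az+b$ with $A,b$ having rational entries), either $I'$ is bounded or $\mathbb{Z}^{d'}\cap(I'_\infty\setminus\{0\})\neq\emptyset$.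 The set $S$ is rational MICP-R if it has an MICP formulation induced by some closed convex $M$ whose index set is rationally unbounded. A set $T\subseteq\mathbb{R}^n$ is periodic if there exists $u\in\mathbb{R}^n\setminus\{0\}$ such that $x+\lambda u\in T$ for all $x\in T$ and $\lambda\in\mathbb{N}$. The diameter of $C\subseteq\mathbb{R}^n$ is $\sup\{\|x-x'\|_2 : x,x'\in C\}$. *)

(* Defs.v *)
From mathcomp Require Import all_boot all_order all_algebra.
From mathcomp Require Import all_classical all_reals all_analysis.

Set Implicit Arguments.
Unset Strict Implicit.
Unset Printing Implicit Defensive.

Import Order.TTheory GRing.Theory Num.Theory.
Import numFieldNormedType.Exports.

Local Open Scope classical_set_scope.
Local Open Scope ring_scope.

(* Points of R^n are row vectors, so a linear map acts by right multiplication
   and (x, y, z) is the concatenation of three rows. *)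

(* The library norm on 'rV[R]_n is the sup norm; it induces the same topology
   and bounded sets, but the diameter is measured with the Euclidean norm. *)
Definition norm2 (R : realType) (n : nat) (x : 'rV[R]_n) : R :=
  Num.sqrt (\sum_(i < n) x ord0 i ^+ 2).

(* Valued in \bar R: +oo for unbounded sets, and -oo for the empty set. *)
Definition diameter (R : realType) (n : nat) (C : set 'rV[R]_n) : \bar R :=
  ereal_sup [set (norm2 (x.1 - x.2))%:E | x in C `*` C].

Definition integer_points (R : realType) (d : nat) : set 'rV[R]_d :=
  range (fun z : 'rV[int]_d => map_mx intr z).

Definition induces_MICP (R : realType) (n p d : nat)
    (M : set 'rV[R]_(n + p + d)) (S : set 'rV[R]_n) : Prop :=
  [/\ closed M, convex_set M &
    forall x : 'rV[R]_n, S x <->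
      exists (y : 'rV[R]_p) (z : 'rV[R]_d),
        @integer_points R d z /\ M (row_mx (row_mx x y) z)].

Definition index_set (R : realType) (n p d : nat)
    (M : set 'rV[R]_(n + p + d)) : set 'rV[R]_d :=
  rsubmx @` M.

Definition recession_cone (R : realType) (d : nat) (C : set 'rV[R]_d) :
    set 'rV[R]_d :=
  [set r | forall (x : 'rV[R]_d) (l : R), C x -> 0 <= l -> C (x + l *: r)].

Definition rational_affine (R : realType) (d d' : nat)
    (A : 'M[rat]_(d, d')) (b : 'rV[rat]_d') (z : 'rV[R]_d) : 'rV[R]_d' :=
  z *m map_mx ratr A + map_mx ratr b.

(* Only meaningful for convex I; index sets of convex M always are. *)
Definition rationally_unbounded (R : realType) (d : nat) (I : set 'rV[R]_d) :
    Prop :=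
  forall (d' : nat) (A : 'M[rat]_(d, d')) (b : 'rV[rat]_d'),
    let I' := rational_affine A b @` I in
    bounded_set I' \/
    @integer_points R d' `&` (recession_cone I' `\ 0) !=set0.

Definition rational_MICP_R (R : realType) (n : nat) (S : set 'rV[R]_n) : Prop :=
  exists (p d : nat) (M : set 'rV[R]_(n + p + d)),
    induces_MICP M S /\ rationally_unbounded (index_set M).

Definition periodic_set (R : realType) (n : nat) (T : set 'rV[R]_n) : Prop :=
  exists2 u : 'rV[R]_n, u != 0 &
    forall (x : 'rV[R]_n) (k : nat), T x -> (0 < k)%N -> T (x + k%:R *: u).

(* Main.v *)
Require Import Defs.
From mathcomp Require Import all_boot all_order all_algebra.
From mathcomp Require Import all_classical all_reals all_analysis.
From mathcomp Require Import zify ring lra.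
Set Implicit Arguments.
Unset Strict Implicit.
Unset Printing Implicit Defensive.

Import Order.TTheory GRing.Theory Num.Theory.
Import numFieldNormedType.Exports.
Local Open Scope classical_set_scope.
Local Open Scope ring_scope.

(** For a point w, let A w be the set of the x that sit above w in the convex
    set projected to its (x, z) coordinates.  Then A is concave,
      (1 - t) A(w) + t A(w') `<=` A((1 - t) w + t w'),
    and S is the union of the A(z) over integer z; on those the convex sets A(z)
    have diameter at most D.  If only finitely many A(z) are nonempty, their
    closures are the compact convex pieces.

    Otherwise the index set has an integer recession direction rho; doubled, it
    preserves the classes modulo 2.  Take points x_m in A(w + m rho) with w
    integral.  By concavity the chord from x_0 to x_m
    meets A(w + k rho) for every k <= m, and that set has diameter at most D and
    contains x_k; hence (x_m - x_0) / m is a Cauchy sequence, with a limit u,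
    and x_m - x_0 - m u stays bounded.  The midpoints of x_m and x'_0 and of x_0
    and x'_m lie in one and the same A at (w + w' + m rho) / 2, so that if this
    is an integer point then u is also the drift for x' above w'.  Thus u depends
    only on the class of w modulo 2.  For any x in A(w), integral or not, the
    chords from x to far points x_m in turn show that x + l u lies in the closure
    of A(w + l rho) as soon as w + l rho is in the class (common_drift).

    Fix one of the finitely many classes.  If u is nonzero, the closure of the
    part of S above the class is periodic with period u.  If u = 0, the rho
    coordinate of z is irrelevant: x stays in S when z moves along rho, over real
    distances, until it meets the class.  So the class may be enlarged to all z
    that agree with a point of the class modulo the line of rho, and this does
    not leave S (class_coverable).  The enlarged set is again of the same kind
    with z replaced by its image under a rational matrix of smaller rank, and an
    induction on that rank finishes the proof (layer_coverable).  The rational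
    unboundedness of the index set supplies an integer recession direction, or
    boundedness, at every stage. *)

(** * Convexity, closures and limits *)

Lemma convex_setP (R : realType) (V : lmodType R) (C : set V) :
  convex_set C <-> forall x y t, 0 <= t <= 1 -> C x -> C y ->
                   C (x + t *: (y - x)).
Proof.
have E (x y : V) (t : R) : t *: y + (1 - t) *: x = x + t *: (y - x).
  by rewrite scalerBr scalerBl scale1r addrCA.
split=> [cC x y t /andP[t0 t1] Cx Cy | cC x y l].
  have := cC y x (Itv01 t0 t1); rewrite !inE => /(_ Cy Cx).
  by rewrite -E.
rewrite !inE => Cx Cy; rewrite -[conv l x y]/(l%:num *: x + (1 - l%:num) *: y) E.
by apply: cC => //; apply/andP; split.
Qed.

Lemma closure_normP (R : realType) (V : normedModType R) (A : set V) (p : V) :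
  closure A p <-> forall e : R, 0 < e -> exists2 a, A a & `|p - a| < e.
Proof.
split=> [clA e e0 | H B /nbhs_normP[e /= e0 eB]].
  have /clA[a [Aa /= pa]] : nbhs p [set a | `|p - a| < e].
    by apply/nbhs_normP; exists e => //= a.
  by exists a.
by have [a Aa pa] := H e e0; exists a; split=> //; apply: eB.
Qed.

(** The bound D / k.+1 survives in the limit, which keeps the distance between
    (k + 1) u and (k + 1) q_k below D, uniformly in k. *)
Lemma cauchy_rate (R : realType) (n : nat) (q : nat -> 'rV[R]_n) (D : R) :
  (forall k m, (k <= m)%N -> `|q m - q k| <= D / k.+1%:R) ->
  exists u, forall k, `|u - q k| <= D / k.+1%:R.
Proof.
move=> qD.
have D0 : 0 <= D.
  by have := qD 0%N 0%N (leqnn _); rewrite subrr normr0 divr1.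
have rate (e : R) : 0 < e -> exists k, D / k.+1%:R < e.
  move=> e0; exists (Num.truncn (D / e)); rewrite ltr_pdivrMr ?ltr0n//.
  rewrite mulrC -ltr_pdivrMr//.
  by have /andP[] := Num.Theory.truncn_itv (divr_ge0 D0 (ltW e0)).
have : cvg (q k @[k --> \oo]).
  apply: cauchy_cvg; apply/cauchy_exP => e e0.
  have [k ke] := rate e e0.
  exists (q k); exists k => // m /= km.
  by rewrite -ball_normE /= distrC (le_lt_trans (qD _ _ km)).
move=> /cvg_ex[u qu]; exists u => k.
apply/ler_addgt0Pr => e e0.
move/cvgrPdist_lt : qu => /(_ e e0)[m _ mu].
have um : `|u - q (maxn k m)| < e by apply: mu; rewrite /= leq_maxr.
rewrite -(subrKA (q (maxn k m))) (le_trans (ler_normD _ _))// addrC lerD//.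
  by rewrite qD// leq_maxl.
exact: ltW.
Qed.

(** * The drift of a concave family along a recession direction *)

Definition concave_family (R : realType) (n d : nat)
    (A : 'rV[R]_d -> set 'rV[R]_n) :=
  forall w w' x x' t, 0 <= t <= 1 -> A w x -> A w' x' ->
    A (w + t *: (w' - w)) (x + t *: (x' - x)).

(** In the application L is a lattice coset, on which the fibers have bounded
    diameter, and L' is a coset of the twice coarser lattice, so that midpoints
    of points of L' fall in L. *)
Section Drift.
Context (R : realType) (n d : nat).
Variables (A : 'rV[R]_d -> set 'rV[R]_n) (L L' : set 'rV[R]_d).
Variables (rho : 'rV[R]_d) (D : R).
Hypothesis concA : concave_family A.
Hypothesis recA : forall w l, A w !=set0 -> 0 <= l -> A (w + l *: rho) !=set0.
Hypothesis diamA : forall w x x', L w -> A w x -> A w x' -> `|x - x'| <= D.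
Hypothesis midL : forall w w' (k : nat), L' w -> L' w' ->
  L (2^-1 *: (w + w' + k%:R *: rho)).

Let subL w (k : nat) : L' w -> L (w + k%:R *: rho).
Proof.
move=> L'w; have := midL (2 * k) L'w L'w.
have -> // : 2^-1 *: (w + w + (2 * k)%:R *: rho) = w + k%:R *: rho.
by apply/rowP => i; rewrite !mxE natrM; field.
Qed.

(* With q k = (x (k + 1) - x 0) / (k + 1), the chord from x 0 to x (m + 1) passes
   at x 0 + (k + 1) q m above w + (k + 1) rho, next to x (k + 1). *)
Let drift_sequence w (x : nat -> 'rV[R]_n) :
  L' w -> (forall m, A (w + m%:R *: rho) (x m)) ->
  exists u, forall m, `|x m - (x 0%N + m%:R *: u)| <= D.
Proof.
move=> L'w Ax.
pose q k : 'rV[R]_n := k.+1%:R^-1 *: (x k.+1 - x 0%N).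
have chord k m : (k <= m)%N -> `|k.+1%:R *: (q m - q k)| <= D.
  move=> km.
  have t01 : 0 <= (k.+1%:R / m.+1%:R : R) <= 1.
    apply/andP; split; first by rewrite divr_ge0.
    by rewrite ler_pdivrMr ?ltr0n// mul1r ler_nat.
  have := concA t01 (Ax 0%N) (Ax m.+1).
  have -> : w + 0%:R *: rho +
      (k.+1%:R / m.+1%:R) *: (w + m.+1%:R *: rho - (w + 0%:R *: rho)) =
      w + k.+1%:R *: rho.
    by apply/rowP => i; rewrite !mxE; field.
  move=> /(diamA (subL k.+1 L'w))/(_ (Ax k.+1)).
  suff -> : k.+1%:R *: (q m - q k) = x 0%N +
      (k.+1%:R / m.+1%:R) *: (x m.+1 - x 0%N) - x k.+1 by [].
  by rewrite /q; apply/rowP => i; rewrite !mxE; field; rewrite !nat1r !pnatr_eq0.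
have [k1 m1 km|u uq] := @cauchy_rate R n q D.
  rewrite ler_pdivlMr ?ltr0n// mulrC.
  by have := chord _ _ km; rewrite normrZ ger0_norm ?ler0n.
exists u => -[|m].
  rewrite scale0r addr0 subrr normr0.
  by have := diamA (subL 0 L'w) (Ax 0%N) (Ax 0%N); rewrite subrr normr0.
have := uq m; rewrite ler_pdivlMr ?ltr0n// mulrC.
rewrite -[X in X * _]ger0_norm ?ler0n// -normrZ -normrN.
suff -> : - (m.+1%:R *: (u - q m)) = x m.+1 - (x 0%N + m.+1%:R *: u) by [].
by rewrite /q; apply/rowP => i; rewrite !mxE; field.
Qed.

(* The midpoints of x m, x' 0 and of x 0, x' m lie above the same point, so they
   are D-close: x' m - x' 0 and x m - x 0 differ by at most 2 D. *)
Let drift_common w w' (x x' : nat -> 'rV[R]_n) u :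
  L' w -> L' w' -> (forall m, A (w + m%:R *: rho) (x m)) ->
  (forall m, A (w' + m%:R *: rho) (x' m)) ->
  (forall m, `|x m - (x 0%N + m%:R *: u)| <= D) ->
  forall m, `|x' m - (x' 0%N + m%:R *: u)| <= 3 * D.
Proof.
move=> L'w L'w' Ax Ax' xu m.
have h01 : 0 <= (2^-1 : R) <= 1 by apply/andP; split; lra.
have M v v' y y' z : A v y -> A v' y' ->
    2^-1 *: (v + v') = z -> A z (2^-1 *: (y + y')).
  move=> Av Av' <-; have := concA h01 Av Av'.
  by congr (A _ _); apply/rowP => i; rewrite !mxE; field.
have mid := midL m L'w L'w'.
have Ma : A (2^-1 *: (w + w' + m%:R *: rho)) (2^-1 *: (x m + x' 0%N)).
  apply: (M _ _ _ _ _ (Ax m) (Ax' 0%N)).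
  by rewrite scale0r addr0 addrAC.
have Mb : A (2^-1 *: (w + w' + m%:R *: rho)) (2^-1 *: (x 0%N + x' m)).
  apply: (M _ _ _ _ _ (Ax 0%N) (Ax' m)).
  by rewrite scale0r addr0 addrA.
have {Ma Mb} := diamA mid Mb Ma.
rewrite -scalerBr normrZ ger0_norm ?invr_ge0 ?ler0n// => ab.
have -> : x' m - (x' 0%N + m%:R *: u) =
   (x 0%N + x' m - (x m + x' 0%N)) + (x m - (x 0%N + m%:R *: u)).
  by apply/rowP => i; rewrite !mxE; ring.
have := ler_normD (x 0%N + x' m - (x m + x' 0%N)) (x m - (x 0%N + m%:R *: u)).
move: (xu m) ab; set a := `|_ - _| ; set b := `|_ - _|; set c := `|_ + _|.
by move=> *; lra.
Qed.

(** The chord from x to a point y m above w + (l + m) rho passes above w + l rho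
    at x + (l / (m + l)) (y m - x).  As y m - x is (m + l) u up to a bounded
    error, these points tend to x + l u.  Only the end point w + l rho has to be
    in L'; that w and l are arbitrary matters when the drift u vanishes. *)
Lemma common_drift : exists u, forall w x l, A w x -> 0 <= l ->
  L' (w + l *: rho) -> closure (A (w + l *: rho)) (x + l *: u).
Proof.
have [[w0 [L'w0 A0]]|none] := pselect (exists w, L' w /\ A w !=set0); last first.
  exists 0 => w x l Aw l0 L'w; case: none; exists (w + l *: rho); split=> //.
  by apply: recA => //; exists x.
have along w : A w !=set0 -> exists x : nat -> 'rV[R]_n,
    forall m, A (w + m%:R *: rho) (x m).
  move=> Aw; have /choice[x xP] : forall m : nat,
    exists x, A (w + m%:R *: rho) x by move=> m; apply: recA.
  by exists x.
have [x0 Ax0] := along w0 A0.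
have [u ux0] := drift_sequence L'w0 Ax0.
exists u => w x l Awx; rewrite le_eqVlt => /predU1P[<- _|l0 L'w].
  by rewrite !scale0r !addr0; apply: subset_closure.
(* The sequence y starts at w + l rho, where the diameter bound is available,
   and not at w. *)
have Awl : A (w + l *: rho) !=set0 by apply: recA; [exists x|exact: ltW].
have [y Ay] := along _ Awl.
have yu := drift_common L'w0 L'w Ax0 Ay ux0.
(* E bounds the error of y m - x from (m + l) u for all m at once. *)
pose E := 3 * D + `|y 0%N - x - l *: u|.
have E0 : 0 <= E by rewrite addr_ge0// (le_trans _ (yu 0%N)).
apply/closure_normP => e e0.
pose m := (Num.truncn (l * E / e)).+1.
have ml : 0 < m%:R + l :> R by rewrite ltr_wpDl ?ler0n.
have t01 : 0 <= l / (m%:R + l) <= 1.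
  apply/andP; split; first by rewrite divr_ge0 ?ltW.
  by rewrite ler_pdivrMr// mul1r lerDr.
exists (x + (l / (m%:R + l)) *: (y m - x)).
  have := concA t01 Awx (Ay m); congr (A _ _).
  by apply/rowP => i; rewrite !mxE; field; rewrite gt_eqF.
have -> : x + l *: u - (x + (l / (m%:R + l)) *: (y m - x)) =
   - (l / (m%:R + l)) *: ((y m - (y 0%N + m%:R *: u)) + (y 0%N - x - l *: u)).
  by apply/rowP => i; rewrite !mxE; field; rewrite gt_eqF.
rewrite normrZ normrN ger0_norm; last by case/andP: t01.
apply: (@le_lt_trans _ _ (l / (m%:R + l) * E)).
  rewrite ler_wpM2l//; first by case/andP: t01.
  by rewrite (le_trans (ler_normD _ _))// lerD.
rewrite mulrAC ltr_pdivrMr//.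
have /andP[_] := Num.Theory.truncn_itv (divr_ge0 (mulr_ge0 (ltW l0) E0) (ltW e0)).
rewrite -/m ltr_pdivrMr// [X in _ < X]mulrC => /lt_le_trans; apply.
by rewrite ler_wpM2l ?(ltW e0)// lerDl ltW.
Qed.

End Drift.

(** * Finite unions of admissible pieces *)

Definition piece (R : realType) (n : nat) (S P : set 'rV[R]_n) :=
  P `<=` S /\ ((compact P /\ convex_set P) \/ (closed P /\ periodic_set P)).

(** The pieces need only cover X, although they must stay inside S: the sets X
    met in the induction need not be closed, but S is. *)
Definition coverable (R : realType) (n : nat) (S X : set 'rV[R]_n) :=
  exists F : set (set 'rV[R]_n),
    [/\ finite_set F, F `<=` piece S & X `<=` \bigcup_(P in F) P].

Lemma coverable_piece (R : realType) (n : nat) (S X P : set 'rV[R]_n) :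
  X `<=` P -> piece S P -> coverable S X.
Proof.
move=> XP pP; exists [set P]; split; first exact: finite_set1.
  by move=> _ ->.
by move=> x Xx; exists P => //; apply: XP.
Qed.

Lemma coverable_bigcup (R : realType) (n : nat) (I : Type) (J : set I)
    (S : set 'rV[R]_n) (X : I -> set 'rV[R]_n) :
  finite_set J -> (forall i, J i -> coverable S (X i)) ->
  coverable S (\bigcup_(i in J) X i).
Proof.
move=> finJ cX.
have /choice[F FP] : forall i, exists F : set (set 'rV[R]_n), J i ->
    [/\ finite_set F, F `<=` piece S & X i `<=` \bigcup_(P in F) P].
  move=> i; have [Ji|nJi] := pselect (J i); last by exists set0.
  by have [F FP] := cX i Ji; exists F.
exists (\bigcup_(i in J) F i); split.
- by apply: bigcup_finite => // i /FP[].
- by move=> P [i /FP[_ + _]]; apply.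
- move=> x [i Ji Xx]; have [_ _ /(_ x Xx)[P FP' Px]] := FP i Ji.
  by exists P => //; exists i.
Qed.

Lemma coverableS (R : realType) (n : nat) (S X Y : set 'rV[R]_n) :
  X `<=` Y -> coverable S Y -> coverable S X.
Proof. by move=> XY [F [? ? YF]]; exists F; split=> // x /XY/YF. Qed.

Lemma convex_closure (R : realType) (n : nat) (C : set 'rV[R]_n) :
  convex_set C -> convex_set (closure C).
Proof.
move=> /convex_setP cC; apply/convex_setP => x y t t01 clx cly.
apply/closure_normP => e e0.
have [x' Cx' xx'] := (closure_normP C x).1 clx e e0.
have [y' Cy' yy'] := (closure_normP C y).1 cly e e0.
exists (x' + t *: (y' - x')); first exact: cC.
have -> : x + t *: (y - x) - (x' + t *: (y' - x')) =
          (1 - t) *: (x - x') + t *: (y - y').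
  by apply/rowP => i; rewrite !mxE; ring.
rewrite (le_lt_trans (ler_normD _ _))// !normrZ.
case/andP: t01 => t0 t1; rewrite !ger0_norm ?subr_ge0//.
have [->|tN0] := eqVneq t 0; first by rewrite subr0 mul1r mul0r addr0.
rewrite [ltRHS](_ : e = (1 - t) * e + t * e); last by ring.
apply: ler_ltD; first by rewrite ler_wpM2l ?subr_ge0 ?(ltW xx').
by rewrite ltr_pM2l// lt_neqAle eq_sym tN0.
Qed.

(** * Images of the integer lattice under rational matrices *)

Lemma matrix_denominator (m n : nat) (M : 'M[rat]_(m, n)) :
  exists (q : nat) (Z : 'M[int]_(m, n)),
    (0 < q)%N /\ map_mx intr Z = q%:R *: M.
Proof.
pose P : int := \prod_(ij : 'I_m * 'I_n) denq (M ij.1 ij.2).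
have P0 : 0 < P by apply: prodr_gt0 => ij _; exact: denq_gt0.
exists `|P|%N, (\matrix_(i, j) (numq (M i j) *
   \prod_(ij | ij != (i, j)) denq (M ij.1 ij.2))); split.
  by rewrite absz_gt0 gt_eqF.
apply/matrixP => i j; rewrite !mxE.
have -> : (`|P|%N)%:R = P%:~R :> rat.
  by rewrite -[in RHS](gtz0_abs P0).
rewrite /P [in RHS](bigD1 (i, j))//= !intrM mulrAC; congr (_ * _).
by rewrite -[X in _ * X]divq_num_den mulrC divfK// intr_eq0 denq_neq0.
Qed.

Lemma finite_bounded_int (d : nat) (K : nat) :
  finite_set [set k : 'rV[int]_d | forall i, (`|k ord0 i| <= K)%N].
Proof.
pose f (g : 'rV['I_(K + K).+1]_d) : 'rV[int]_d := 
  map_mx (fun i : 'I_(K + K).+1 => i%:Z - K%:Z) g.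
apply: (@sub_finite_set _ _ (f @` setT)); last first.
  by apply: finite_image; exact: finite_finset.
move=> k kK; exists (map_mx (fun z : int => inord (absz (z + K%:Z)%R)) k) => //.
apply/rowP => i; rewrite !mxE.
have := kK i; move: (k 0 i) => z zK.
by rewrite inordK; lia.
Qed.

(** If q B is an integer matrix, q v is an integer vector of norm at most q K. *)
Lemma finite_bounded_lattice (R : realType) (d : nat) (B : 'M[rat]_d) (K : R) :
  finite_set [set v : 'rV[R]_d | `|v| <= K /\
    exists k : 'rV[int]_d, v = map_mx intr k *m map_mx ratr B].
Proof.
have [q [Z [q0 ZB]]] := matrix_denominator B.
have qR0 : q%:R != 0 :> R by rewrite pnatr_eq0 -lt0n.
pose K' := Num.truncn (q%:R * K).
apply: (@sub_finite_set _ _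
  ((fun k : 'rV[int]_d => q%:R^-1 *: map_mx intr k : 'rV[R]_d) @`
   [set k : 'rV[int]_d | forall i, (`|k ord0 i| <= K')%N])); last first.
  exact/finite_image/finite_bounded_int.
move=> v /= [vK [k vk]].
have qv : map_mx intr (k *m Z) = q%:R *: v.
  have -> : map_mx intr (k *m Z) = map_mx intr k *m map_mx intr Z :> 'M[R]_(_, _).
    exact: map_mxM.
  have -> : map_mx intr Z = q%:R *: map_mx ratr B :> 'M[R]_d.
    have -> : map_mx intr Z = map_mx ratr (map_mx intr Z) :> 'M[R]_d.
      by apply/matrixP => i j; rewrite !mxE ratr_int.
    by rewrite ZB; apply/matrixP => i j; rewrite !mxE rmorphM/= ratr_nat.
  by rewrite vk scalemxAr.
exists (k *m Z) => [i|]; last by rewrite qv scalerA mulVf// scale1r.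
have K0 : 0 <= q%:R * K by rewrite mulr_ge0// (le_trans _ vK).
rewrite /K' truncn_ge_nat//.
have -> : (`|(k *m Z) ord0 i|%N)%:R = `|q%:R * v ord0 i| :> R.
  have /rowP/(_ i) := qv; rewrite [in LHS]mxE [in RHS]mxE => <-.
  by rewrite -intr_norm -abszE.
rewrite normrM ger0_norm// ler_wpM2l// (le_trans _ vK)//.
by rewrite [leRHS]/Num.norm/= mx_normrE; exact: (le_bigmax _ _ (ord0, i)).
Qed.

Lemma map_intrMn (R : realType) (d : nat) (r : 'rV[int]_d) (k : nat) :
  map_mx intr (r *+ k) = k%:R *: map_mx intr r :> 'rV[R]_d.
Proof. by apply/rowP => i; rewrite !mxE mulmxnE mulr_natl rmorphMn. Qed.

(** * Layers of the union above lattice cosets *)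

Section Layers.
Context (R : realType) (n d : nat).
Variables (S : set 'rV[R]_n) (G : set ('rV[R]_n * 'rV[R]_d)) (D : R).
Hypothesis closedS : closed S.
Hypothesis convG : convex_set G.
Hypothesis diamS : forall C : set 'rV[R]_n, convex_set C -> C `<=` S ->
  forall x y : 'rV[R]_n, C x -> C y -> `|x - y| <= D.
Hypothesis ratG : rationally_unbounded (snd @` G).

(** Seeing z only through a matrix B, possibly singular, is how coordinates of z
    are forgotten: the fibers over w for all z with the same image are merged. *)
Definition fiber (B : 'M[rat]_d) (w : 'rV[R]_d) : set 'rV[R]_n :=
  [set x | exists2 z, G (x, z) & z *m map_mx ratr B = w].

Definition lattice (e : 'rV[R]_d) (N : nat) (B : 'M[rat]_d) : set 'rV[R]_d :=
  [set (e + N%:R *: map_mx intr k) *m map_mx ratr B | k in [set: 'rV[int]_d]].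

Definition layer e N B := \bigcup_(w in lattice e N B) fiber B w.

Lemma concave_fiber B : concave_family (fiber B).
Proof.
move=> w w' x x' t t01 [z Gz <-] [z' Gz' <-].
exists (z + t *: (z' - z)); last by rewrite mulmxDl -scalemxAl mulmxBl.
by have /convex_setP/(_ _ _ t t01 Gz Gz') := convG.
Qed.

Lemma convex_fiber B w : convex_set (fiber B w).
Proof.
apply/convex_setP => x y t t01 Bx By.
by have := concave_fiber t01 Bx By; rewrite subrr scaler0 addr0.
Qed.

Lemma piece_fiber B w : fiber B w `<=` S -> piece S (closure (fiber B w)).
Proof.
move=> BS.
have clS : closure (fiber B w) `<=` S.
  by rewrite [X in _ `<=` X]((closure_id S).1 closedS); exact: closureS.
have cv := convex_closure (@convex_fiber B w).
split=> //; left; split=> //; apply: bounded_closed_compact;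
  last exact: closed_closure.
have [[x xB]|nB] := pselect (closure (fiber B w) !=set0); last first.
  exists 0; split; first exact: real0.
  by move=> M _ y By; case: nB; exists y.
exists (`|x| + D); split; first exact: num_real.
move=> M xM y By; rewrite /= (le_trans _ (ltW xM))//.
rewrite -(subrK x y) addrC (le_trans (ler_normD _ _))// lerD//.
exact: (diamS cv clS).
Qed.

(** Two lattice points with nonempty fibers differ by N times a bounded point of
    the image of the integer lattice, so only finitely many fibers occur. *)
Lemma bounded_coverable B N e : (0 < N)%N ->
  bounded_set [set w | fiber B w !=set0] -> layer e N B `<=` S ->
  coverable S (layer e N B).
Proof.
move=> N0 [K [_ Kb]] LS.
have NR0 : N%:R != 0 :> R by rewrite pnatr_eq0 -lt0n.
pose e' := e *m map_mx ratr B.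
pose W := [set w | lattice e N B w /\ fiber B w !=set0].
apply: (@coverableS _ _ _ _ (\bigcup_(w in W) fiber B w)).
  by move=> x [w Lw Bx]; exists w => //; split=> //; exists x.
apply: coverable_bigcup => [|w [Lw _]]; last first.
  have wS : fiber B w `<=` S by move=> x Bx; apply: LS; exists w.
  exact: coverable_piece (@subset_closure _ _) (piece_fiber wS).
apply: (@sub_finite_set _ _ ((fun v => e' + N%:R *: v) @`
  [set v : 'rV[R]_d | `|v| <= N%:R^-1 * (K + 1 + `|e'|) /\
    exists k : 'rV[int]_d, v = map_mx intr k *m map_mx ratr B])).
  move=> w [[k _ <-] Bw]; exists (map_mx intr k *m map_mx ratr B).
    split; last by exists k.
    have {Bw} := Kb (K + 1) _ _ Bw; rewrite ltrDl => /(_ ltr01).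
    rewrite mulmxDl -scalemxAl -/e' /= => wK.
    rewrite ler_pdivlMl ?ltr0n//.
    rewrite -[X in X * _]ger0_norm// -normrZ.
    rewrite -[X in `|X| <= _](addKr e') addrC (le_trans (ler_normB _ _))// lerD2r.
    exact: wK.
  by rewrite mulmxDl -scalemxAl.
exact/finite_image/finite_bounded_lattice.
Qed.


(** A coset of a lattice splits into the 2 ^ d cosets of its double. *)
Lemma layer_halving N e B : layer e N B `<=`
  \bigcup_(b in [set: 'rV[bool]_d])
    layer (e + N%:R *: map_mx (fun c : bool => (c : nat)%:R) b) (2 * N) B.
Proof.
move=> x [w [k _ <-] Bx].
exists (map_mx (fun z : int => (z %% 2)%Z == 1) k) => //.
exists ((e + N%:R *: map_mx intr k) *m map_mx ratr B) => //.
exists (map_mx (fun z : int => (z %/ 2)%Z) k) => //; congr (_ *m _).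
rewrite -addrA; congr (_ + _); apply/rowP => i; rewrite !mxE.
set z := k _ _.
have -> : z%:~R = ((z %% 2)%Z == 1 : nat)%:R + 2%:R * (z %/ 2)%Z%:~R :> R.
  have {1}-> : z = ((z %% 2)%Z == 1 : nat)%:Z + 2 * (z %/ 2)%Z by lia.
  by rewrite intrD intrM.
by rewrite natrM; ring.
Qed.

Lemma latticeD N e B w (r : 'rV[int]_d) :
  lattice e N B w ->
  lattice e N B (w + N%:R *: (map_mx intr r *m map_mx ratr B)).
Proof.
move=> [k _ <-]; exists (k + r) => //.
by rewrite map_mxD scalerDr addrA [in RHS]scalemxAl -mulmxDl.
Qed.

Lemma lattice_midpoint N e (c : 'rV[int]_d) B w w' (r : 'rV[int]_d) (k : nat) :
  let e' := e + N%:R *: map_mx intr c in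
  lattice e' (2 * N) B w -> lattice e' (2 * N) B w' ->
  lattice e N B (2^-1 *: (w + w' + k%:R *:
    ((2 * N)%:R *: (map_mx intr r *m map_mx ratr B)))).
Proof.
move=> e' [a _ <-] [b _ <-]; exists (c + a + b + r *+ k) => //.
rewrite !scalemxAl -!mulmxDl scalemxAl; congr (_ *m _).
by rewrite !map_mxD map_intrMn; apply/rowP => i; rewrite !mxE natrM; field.
Qed.

(** The recession direction rB is the image of an integer vector, so that
    translations by 2 N rB preserve the cosets of the double lattice. *)
Section Recession.
Variables (B : 'M[rat]_d) (r : 'rV[int]_d).
Let rB : 'rV[R]_d := map_mx intr r *m map_mx ratr B.
Hypothesis recB : forall w l, fiber B w !=set0 -> 0 <= l ->
  fiber B (w + l *: rB) !=set0.

Lemma layer_drift N e (c : 'rV[int]_d) : layer e N B `<=` S ->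
  exists u : 'rV[R]_n, forall w x l, fiber B w x -> 0 <= l ->
    lattice (e + N%:R *: map_mx intr c) (2 * N) B (w + l *: ((2 * N)%:R *: rB)) ->
    closure (fiber B (w + l *: ((2 * N)%:R *: rB))) (x + l *: u).
Proof.
move=> LS; set e' := e + _.
apply: (@common_drift _ _ _ (fiber B) (lattice e N B) (lattice e' (2 * N) B) _ D).
- exact: concave_fiber.
- by move=> w l Bw l0; rewrite scalerA; apply: recB => //; rewrite mulr_ge0.
- move=> w x y Lw; apply: (diamS (@convex_fiber B w)).
  by move=> z Bz; apply: LS; exists w.
- by move=> w w' k Lw Lw'; apply: lattice_midpoint Lw Lw'.
Qed.

(** If the drift u is nonzero, the closure of the layer is one periodic piece.
    If u = 0, the matrix cokermx v, whose left kernel is the line of v, may be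
    applied without leaving S: a point x above z with z equal to a coset point
    modulo that line is moved along rB, at a real distance t + K, to a point of
    the coset, and common_drift with u = 0 leaves x in the closure of that
    fiber. *)
Lemma class_coverable N e (c : 'rV[int]_d) : (0 < N)%N ->
  let e' := e + N%:R *: map_mx intr c in
  let v := map_mx intr r *m B : 'rV[rat]_d in
  (layer e' (2 * N) (B *m cokermx v) `<=` S ->
   coverable S (layer e' (2 * N) (B *m cokermx v))) ->
  layer e N B `<=` S ->
  coverable S (layer e' (2 * N) B).
Proof.
move=> N0 e' v IH LS.
have [u uP] := layer_drift c LS.
have L'S : layer e' (2 * N) B `<=` S.
  move=> x [w [k _ <-] Bx]; apply: LS.
  exists ((e' + (2 * N)%:R *: map_mx intr k) *m map_mx ratr B) => //.
  exists (c + k *+ 2) => //; congr (_ *m _).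
  rewrite /e' map_mxD map_intrMn.
  by apply/rowP => i; rewrite !mxE natrM; ring.
have clB w : lattice e' (2 * N) B w ->
    closure (fiber B w) `<=` closure (layer e' (2 * N) B).
  by move=> Lw; apply: closureS => x Bx; exists w.
have clS : closure (layer e' (2 * N) B) `<=` S.
  by rewrite [X in _ `<=` X]((closure_id S).1 closedS); exact: closureS.
have [u0|u0] := eqVneq u 0; last first.
  apply: coverable_piece (@subset_closure _ _) _; split=> //; right.
  split; first exact: closed_closure.
  exists u => // x k clx k0; apply/closure_normP => eps eps0.
  have [y [w Lw By] xy] := (closure_normP _ _).1 clx eps eps0.
  have Lwk : lattice e' (2 * N) B (w + k%:R *: ((2 * N)%:R *: rB)).
    rewrite scalerA [X in X *: _]mulrC -scalerA.
    have := latticeD (r *+ k) Lw.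
    suff -> : map_mx intr (r *+ k) *m map_mx ratr B = k%:R *: rB :> 'rV[R]_d by [].
    by rewrite /rB scalemxAl map_intrMn.
  have := clB _ Lwk _ (uP _ _ _ By (ler0n _ _) Lwk).
  move=> /closure_normP/(_ (eps - `|x - y|)).
  rewrite subr_gt0 => /(_ xy)[z Lz yz]; exists z => //.
  have -> : x + k%:R *: u - z = (x - y) + (y + k%:R *: u - z).
    by apply/rowP => i; rewrite !mxE; ring.
  by rewrite (le_lt_trans (ler_normD _ _))// addrC -ltrBrDr.
apply: (@coverableS _ _ _ _ (layer e' (2 * N) (B *m cokermx v))).
  move=> x [w [k _ <-] [z Gz zB]].
  exists ((e' + (2 * N)%:R *: map_mx intr k) *m map_mx ratr (B *m cokermx v)).
    by exists k.
  by exists z => //; rewrite map_mxM !mulmxA zB.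
apply: IH => x [_ [k _ <-] [z Gz zB]].
set a := e' + _ in zB.
have [l aB] : exists l : R, a *m map_mx ratr B = z *m map_mx ratr B + l *: rB.
  have : ((a - z) *m map_mx ratr B <= rB)%MS.
    have -> : rB = map_mx ratr v.
      rewrite /v map_mxM; congr (_ *m _).
      by apply/rowP => i; rewrite !mxE /= ratr_int.
    rewrite submxE -map_cokermx -mulmxA -map_mxM mulmxBl -zB subrr.
    exact/eqP.
  move=> /sub_rVP[l azB]; exists l.
  by rewrite -azB mulmxBl addrC subrK.
pose t := l / (2 * N)%:R.
(* Shifting the coset point by K periods makes the distance nonnegative. *)
have NR0 : (2 * N)%:R != 0 :> R by rewrite pnatr_eq0 muln_eq0 -lt0n.
pose K := (Num.truncn `|t|).+1.
have tK : 0 <= t + K%:R.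
  have := normr_ge0 t => /Num.Theory.truncn_itv/andP[_]; rewrite -/K => tK.
  have := ler_norm (- t); rewrite normrN => ?; lra.
have E : z *m map_mx ratr B + (t + K%:R) *: ((2 * N)%:R *: rB) =
    a *m map_mx ratr B + (2 * N)%:R *: (map_mx intr (r *+ K) *m map_mx ratr B).
  have -> : map_mx intr (r *+ K) *m map_mx ratr B = K%:R *: rB :> 'rV[R]_d.
    by rewrite /rB scalemxAl map_intrMn.
  rewrite aB /t; apply/rowP => i; rewrite !mxE; field.
  by rewrite pnatr_eq0 -lt0n.
have Lw : lattice e' (2 * N) B
    (z *m map_mx ratr B + (t + K%:R) *: ((2 * N)%:R *: rB)).
  by rewrite E; apply: latticeD; exists k.
have Bx : fiber B (z *m map_mx ratr B) x by exists z.
have := uP _ _ _ Bx tK Lw; rewrite u0 scaler0 addr0.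
by move=> /(clB _ Lw)/clS.
Qed.

End Recession.

Lemma fiber_nonempty B w :
  fiber B w !=set0 <-> (rational_affine B 0 @` (snd @` G)) w.
Proof.
split=> [[x [z Gz <-]] | [_ [[x z] Gz <-] <-]].
  exists z; first by exists (x, z).
  by rewrite /rational_affine map_mx0 addr0.
by exists x; exists z => //; rewrite /rational_affine map_mx0 addr0.
Qed.

(** The recession direction r' given by rational unboundedness is an integer
    vector but need not be the image of one.  It is a difference of two points
    of the real row space of B, hence, being rational, it lies in the rational
    row space of B, and a multiple of it is the image of an integer vector. *)
Lemma recession_lift (B : 'M[rat]_d) :
  ~ bounded_set [set w | fiber B w !=set0] ->
  exists r : 'rV[int]_d,
    let rB : 'rV[R]_d := map_mx intr r *m map_mx ratr B in
    rB != 0 /\ forall w l, fiber B w !=set0 -> 0 <= l ->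
      fiber B (w + l *: rB) !=set0.
Proof.
have -> : [set w | fiber B w !=set0] = rational_affine B 0 @` (snd @` G).
  by apply/seteqP; split=> w /fiber_nonempty.
move=> unb; have [//|[r' [[k _ kr'] [rec /eqP r'0]]]] := ratG B 0.
have [w0 Bw0] : exists w, fiber B w !=set0.
  apply: contrapT => none; apply: unb; exists 0; split; first exact: real0.
  by move=> M _ w /fiber_nonempty Bw; case: none; exists w.
have kB : (map_mx intr k <= B)%MS.
  rewrite -(map_submx (ratr : rat -> R)).
  have -> : map_mx ratr (map_mx intr k) = r'.
    by rewrite -kr'; apply/rowP => i; rewrite !mxE /= ratr_int.
  have [x1 [z1 _ z1B]] : fiber B (w0 + 1 *: r') !=set0.
    by apply/fiber_nonempty/rec => //; apply/fiber_nonempty.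
  case: Bw0 => x0 [z0 _ z0B].
  apply/submxP; exists (z1 - z0).
  by rewrite mulmxBl z1B z0B scale1r addrC addKr.
have [t tB] := submxP kB.
have [q [r [q0 rt]]] := matrix_denominator t.
have rB : map_mx intr r *m map_mx ratr B = q%:R *: r' :> 'rV[R]_d.
  have -> : map_mx intr r = map_mx ratr (map_mx intr r) :> 'rV[R]_d.
    by apply/rowP => i; rewrite !mxE /= ratr_int.
  rewrite -map_mxM rt -scalemxAl -tB -kr'.
  by apply/rowP => i; rewrite !mxE /= rmorphM /= ratr_nat ratr_int.
exists r; rewrite rB; split=> [|w l Bw l0].
  by rewrite scaler_eq0 negb_or pnatr_eq0 -lt0n q0.
by rewrite scalerA; apply/fiber_nonempty/rec;
   [exact/fiber_nonempty | rewrite mulr_ge0].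
Qed.

Lemma rank_mul_cokermx (B : 'M[rat]_d) (v : 'rV[rat]_d) :
  v != 0 -> (v <= B)%MS -> (\rank (B *m cokermx v) < \rank B)%N.
Proof.
move=> v0 vB; rewrite -[in X in (_ < X)%N](mxrank_mul_ker B (cokermx v)).
rewrite -addn1 leq_add2l (leq_trans _ (mxrankS (_ : v <= _)%MS))//.
  by rewrite lt0n mxrank_eq0.
by rewrite sub_capmx vB; apply/sub_kermxP; exact: mulmx_coker.
Qed.

(** The induction keeps the dimension d and the lattice coset explicit and lets
    only the rank of B drop. *)
Lemma layer_coverable (m : nat) (B : 'M[rat]_d) (N : nat) (e : 'rV[R]_d) :
  (\rank B < m)%N -> (0 < N)%N -> layer e N B `<=` S -> coverable S (layer e N B).
Proof.
elim: m => // m IH in B N e *; rewrite ltnS => Bm N0 LS.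
have [bd|unb] := pselect (bounded_set [set w | fiber B w !=set0]).
  exact: bounded_coverable.
have [r [rB0 recB]] := recession_lift unb.
apply: coverableS (@layer_halving _ _ _) _.
apply: coverable_bigcup => [|b _]; first exact: finite_finset.
pose c : 'rV[int]_d := map_mx (fun c : bool => (c : nat)%:Z) b.
have -> : map_mx (fun c : bool => (c : nat)%:R) b = map_mx intr c :> 'rV[R]_d.
  by apply/rowP => i; rewrite !mxE.
apply: (class_coverable recB N0 _ LS) => sub.
apply: IH => //; last by rewrite muln_gt0.
apply: leq_trans (rank_mul_cokermx _ _) Bm; last exact: submxMl.
apply: contra rB0 => /eqP v0; apply/eqP.
have -> : map_mx intr r = map_mx ratr (map_mx intr r) :> 'rV[R]_d.
  by apply/rowP => i; rewrite !mxE /= ratr_int.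
by rewrite -map_mxM v0 map_mx0.
Qed.

End Layers.

(** * The decomposition *)

Lemma normr_norm2 (R : realType) (n : nat) (x : 'rV[R]_n) : `|x| <= norm2 x.
Proof.
rewrite [leLHS]/Num.norm/= mx_normrE; apply: bigmax_le => [|[i j] _].
  exact: sqrtr_ge0.
rewrite /norm2 -sqrtr_sqr ler_wsqrtr// (bigD1 j)//= ord1 lerDl.
by apply: sumr_ge0 => ? _; exact: sqr_ge0.
Qed.

Theorem theorem5p1 (R : realType) (n : nat) (hn : (0 < n)%N)
    (S : set 'rV[R]_n) (hclosed : closed S) (hMICP : rational_MICP_R S)
    (hdiam : exists D : R, forall C : set 'rV[R]_n,
      convex_set C -> C `<=` S -> (diameter C <= D%:E)%E) :
  exists (k1 k2 : nat) (C : 'I_k1 -> set 'rV[R]_n)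
    (T : 'I_k2 -> set 'rV[R]_n),
    [/\ forall j, compact (C j) /\ convex_set (C j),
        forall i, closed (T i) /\ periodic_set (T i) &
        S = (\bigcup_j C j) `|` (\bigcup_i T i)].
Proof.
have [p [d [M [[_ convM MS] ratM]]]] := hMICP.
have [D hD] := hdiam.
pose G : set ('rV[R]_n * 'rV[R]_d) :=
  [set xz | exists y : 'rV[R]_p, M (row_mx (row_mx xz.1 y) xz.2)].
have convG : convex_set G.
  apply/convex_setP => -[x z] [x' z'] t t01 [y My] [y' My'].
  exists (y + t *: (y' - y)).
  have /convex_setP/(_ _ _ t t01 My My') := convM.
  by rewrite !opp_row_mx !add_row_mx !scale_row_mx !add_row_mx.
have GI : snd @` G = index_set M.
  apply/seteqP; split=> z /=.
    move=> [[x z'] [y My] <-]; exists (row_mx (row_mx x y) z') => //.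
    by rewrite row_mxKr.
  move=> [w Mw <-]; exists (lsubmx (lsubmx w), rsubmx w) => //.
  by exists (rsubmx (lsubmx w)); rewrite /= !hsubmxK.
have diamS (C : set 'rV[R]_n) : convex_set C -> C `<=` S ->
    forall x y, C x -> C y -> `|x - y| <= D.
  move=> cC CS x y Cx Cy; rewrite (le_trans (normr_norm2 _))//.
  rewrite -lee_fin (le_trans _ (hD C cC CS))//.
  by apply: ereal_sup_ubound; exists (x, y).
have layerE : layer G 0 1 1%:M = S.
  apply/seteqP; split=> x.
    move=> [w [k _ <-] [z [y My] zE]]; apply/MS; exists y, z; split=> //.
    exists k => //; move: zE.
    by rewrite map_mx1 !mulmx1 add0r scale1r.
  move=> /MS[y [z [[k _ kz] My]]]; exists z; last first.
    by exists z; [exists y | rewrite map_mx1 mulmx1].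
  by exists k => //; rewrite map_mx1 mulmx1 add0r scale1r.
have [F [finF FP SF]] : coverable S S.
  rewrite -[X in coverable _ X]layerE.
  apply: (@layer_coverable _ _ _ S G D _ _ _ _ d.+1) => //.
  - by rewrite GI.
  - by rewrite ltnS rank_leq_row.
  - by rewrite layerE.
have /finite_seqP[s1 s1P] : finite_set
    (F `&` [set P : set 'rV[R]_n | compact P /\ convex_set P]).
  exact: finite_setIl.
have /finite_seqP[s2 s2P] : finite_set
    (F `&` [set P : set 'rV[R]_n | closed P /\ periodic_set P]).
  exact: finite_setIl.
exists (size s1), (size s2), (fun j => nth set0 s1 j), (fun i => nth set0 s2 i).
have in1 j : (j < size s1)%N ->
    (F `&` [set P : set 'rV[R]_n | compact P /\ convex_set P]) (nth set0 s1 j).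
  by move=> js; rewrite s1P /=; exact: mem_nth.
have in2 j : (j < size s2)%N ->
    (F `&` [set P : set 'rV[R]_n | closed P /\ periodic_set P]) (nth set0 s2 j).
  by move=> js; rewrite s2P /=; exact: mem_nth.
split=> [j|i|]; [by have [] := in1 j (ltn_ord j)|by have [] := in2 i (ltn_ord i)|].
apply/seteqP; split=> x; last first.
  by move=> [[j _ Px]|[j _ Px]];
     [have [/FP[+ _] _] := in1 j (ltn_ord j)|have [/FP[+ _] _] := in2 j (ltn_ord j)];
     apply.
move=> /SF[P FPP Px]; have [_ [gP|gP]] := FP P FPP.
- left; have : [set` s1] P by rewrite -s1P.
  move=> /= Ps; have js : (index P s1 < size s1)%N by rewrite index_mem.
  by exists (Ordinal js) => //=; rewrite nth_index.
- right; have : [set` s2] P by rewrite -s2P.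
  move=> /= Ps; have js : (index P s2 < size s2)%N by rewrite index_mem.
  by exists (Ordinal js) => //=; rewrite nth_index.
Qed.
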